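(* Let $C,D\subseteq\mathbb{R}^n$ be convex sets such that $C\cap D\neq\emptyset$, and let $T_a=T_a(C,D)$ be their affine joint supporting subspace. Then $$\operatorname{rint}(C\cap T_a)\cap\operatorname{rint}(D\cap T_a)\neq\emptyset.$$
   Context: $\operatorname{rint}$ is the relative interior. $A\pm B=\{a\pm b\mid a\in A,b\in B\}$. Faces: a subset $F\subseteq C$ of a convex set $C\subseteq\mathbb{R}^n$ is a face of $C$ if for all $y,z\in C$, whenever the open segment $]y,z[ = [y,z]\setminus\{y,z\}$ meets $F$, both $y,z\in F$. For $S\subseteq C$, $F_C(S)$ denotes the smallest face of $C$ containing $S$; $F_C(x)=F_C(\{x\})$. Joint supporting subspace: for convex $C,D\subseteq\mathbb{R}^n$ with $C\cap D\neq\emptyset$, $T(C,D):=\operatorname{Span} F_{C-D}(0)$ (linear span) and $T_a(C,D):=T(C,D)+(C\cap D)$. *)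

(* Defs.v *)
From mathcomp Require Import all_boot all_order all_algebra.
From mathcomp Require Import interval_inference.
From mathcomp Require Import all_classical all_reals all_analysis.

Set Implicit Arguments.
Unset Strict Implicit.
Unset Printing Implicit Defensive.

Import Order.TTheory GRing.Theory Num.Theory.
Import numFieldNormedType.Exports.

Local Open Scope classical_set_scope.
Local Open Scope ring_scope.
Local Open Scope convex_scope.

Section Defs.
Context {R : realType} {n : nat}.
Local Notation E := 'rV[R]_n.
Implicit Types (x y z : E) (S F C D : set E).

Definition minkowski_add C D : set E := [set a + b | a in C & b in D].

Definition minkowski_sub C D : set E := [set a - b | a in C & b in D].

Definition segment y z : set E :=
  [set x | exists t : {i01 R}, x = (y : convex_lmodType E) <| t |> z].

Definition open_segment y z : set E := segment y z `\` [set y; z].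

Definition is_face C F : Prop :=
  F `<=` C /\
  forall y z, C y -> C z -> open_segment y z `&` F !=set0 -> F y /\ F z.

(* The intersection of all faces of C containing S. It is meaningful only for
   S `<=` C; it is then itself a face (see smallest_face_is_face). *)
Definition smallest_face C S : set E := smallest (is_face C) S.

Definition linear_span S : set E :=
  [set x | exists (k : nat) (a : 'I_k -> R) (s : 'I_k -> E),
     (forall i, S (s i)) /\ x = \sum_(i < k) a i *: s i].

Definition affine_hull S : set E :=
  [set x | exists (k : nat) (a : 'I_k -> R) (s : 'I_k -> E),
     [/\ forall i, S (s i), \sum_(i < k) a i = 1 &
         x = \sum_(i < k) a i *: s i]].

Definition rint S : set E :=
  [set x | affine_hull S x /\ \forall y \near x, affine_hull S y -> S y].

Definition joint_supporting_subspace C D : set E :=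
  linear_span (smallest_face (minkowski_sub C D) [set 0]).

Definition affine_joint_supporting_subspace C D : set E :=
  minkowski_add (joint_supporting_subspace C D) (C `&` D).

Lemma smallest_face_is_face C S :
  S `<=` C -> is_face C (smallest_face C S).
Proof.
move=> SC; split; first by apply: smallest_sub => //; split.
move=> y z Cy Cz [x [xyz xF]].
by split=> F [[FC Fface] SF]; case: (Fface y z Cy Cz) => //;
  exists x; split=> //; apply: xF.
Qed.

Lemma rint_sub S : rint S `<=` S.
Proof. by move=> x [xS /nbhs_singleton]; apply. Qed.

End Defs.

(* Main.v *)
Require Import Defs.
From mathcomp Require Import all_boot all_order all_algebra.
From mathcomp Require Import all_classical all_reals all_analysis.
From mathcomp Require Import interval_inference ring lra.
Import Order.TTheory GRing.Theory Num.Theory numFieldNormedType.Exports.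

Local Open Scope classical_set_scope.
Local Open Scope ring_scope.

(** Put G = C - D.  Since G is convex and contains 0, the smallest face of G
    containing 0 consists of the points u of G for which some -r u with r > 0
    is again in G: these points form a face, and conversely 0 lies strictly
    between u and -r u.  Hence its span is the set L of all u such that some
    positive multiple r u satisfies both r u \in G and -(r u) \in G
    (linear_span_face0), and for any x0 in the intersection of C and D the
    affine space T_a is x0 + L (affine_joint_supporting_subspaceE).

    The sets C' = C `&` T_a and D' = D `&` T_a are convex and nonempty, so they
    have relative interior points c and d (rint_nonempty).  As c - d is in L,
    there are r > 0, c' in C and d' in D with c' - d' = - r (c - d), that is,
      p := (r c + c') / (1 + r) = (r d + d') / (1 + r).
    This p belongs to both C and D, hence to T_a; the point c' lies on the line
    through c and p, and d' on the line through d and p, so c' is in C' and d'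
    is in D'.  Thus p is strictly between c and c', or equal to both, and
    similarly for d and d'; since moving from a relative interior point
    towards a point of a convex set preserves relative interiority as long as
    the end is not reached (rint_segment), p is a common relative interior
    point of C' and D'. *)

(** * Convex combinations *)

Section ConvexSets.
Context {R : realType} {n : nat}.
Implicit Types (S C D G : set 'rV[R]_n) (x y z u v : 'rV[R]_n).

(** Replaces the bundled interval parameter of [convex_set] by two nonnegative
    weights, which makes the later choices of weights purely algebraic. *)
Lemma convex_setP S :
  convex_set S <->
  forall x y (a b : R), 0 <= a -> 0 <= b -> a + b = 1 ->
    S x -> S y -> S (a *: x + b *: y).
Proof.
split=> [cS x y a b a0 b0 ab Sx Sy|cS x y t].
  have a1 : a <= 1 by rewrite -ab lerDl.
  have := cS x y (Itv01 a0 a1); rewrite !inE => /(_ Sx Sy).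
  by have -> : b = 1 - a by lra.
rewrite !inE => Sx Sy; apply: cS => //; last by rewrite addrC subrK.
by rewrite subr_ge0.
Qed.

Lemma convex_scaleD S x y (a b : R) : convex_set S -> 0 <= a -> 0 <= b ->
  S x -> S y -> exists2 z, S z & a *: x + b *: y = (a + b) *: z.
Proof.
move=> /convex_setP cS a0 b0 Sx Sy.
have [ab0|ab0] := eqVneq (a + b) 0.
  have -> : a = 0 by lra.
  have -> : b = 0 by lra.
  by exists x => //; rewrite addr0 !scale0r addr0.
exists ((a / (a + b)) *: x + (b / (a + b)) *: y); last first.
  by rewrite scalerDr !scalerA ![(a + b) * _]mulrC !divfK.
apply: cS => //; first by rewrite divr_ge0 ?addr_ge0.
  by rewrite divr_ge0 ?addr_ge0.
by rewrite -mulrDl divff.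
Qed.

(** Combinations with total weight at most 1 are allowed because the missing
    weight goes to [x0].  Keeping the sum in the cone form b (q - x0) with [q]
    in [S] makes this an induction on the sum that also covers partial sums of
    total weight 0. *)
Lemma convex_bary S x0 k (v : 'I_k -> 'rV[R]_n) (a : 'I_k -> R) :
  convex_set S -> S x0 -> (forall i, S (x0 + v i)) -> (forall i, 0 <= a i) ->
  \sum_i a i <= 1 -> S (x0 + \sum_i a i *: v i).
Proof.
move=> cS Sx0 Sv a0 a1.
have [s0 [q Sq ->]] : 0 <= \sum_i a i /\
    exists2 q, S q & \sum_i a i *: v i = (\sum_i a i) *: (q - x0).
  apply: (big_ind2 (fun w b =>
      0 <= b /\ exists2 q, S q & w = b *: (q - x0))) => [|w1 b1 w2 b2|i _].
  - by split=> //; exists x0; rewrite ?scale0r.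
  - move=> [b10 [q1 Sq1 ->]] [b20 [q2 Sq2 ->]]; split; first exact: addr_ge0.
    have [z Sz zE] := convex_scaleD S q1 q2 b1 b2 cS b10 b20 Sq1 Sq2.
    exists z => //.
    by rewrite !scalerBr addrACA zE -opprD -scalerDl.
  - by split=> //; exists (x0 + v i) => //; rewrite addrAC subrr add0r.
have -> : x0 + (\sum_i a i) *: (q - x0) =
    (1 - \sum_i a i) *: x0 + (\sum_i a i) *: q.
  by rewrite scalerBr scalerBl scale1r addrA addrAC.
by move/convex_setP : cS; apply => //; rewrite ?subr_ge0 ?subrK.
Qed.

(** * Affine hulls *)

Lemma sub_affine_hull S : S `<=` affine_hull S.
Proof.
move=> x Sx; exists 1%N, (fun=> 1), (fun=> x).
by rewrite !big_ord1 scale1r.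
Qed.

(** Finite dimension enters here: among the families of points of [S], read as
    rows of differences with [x0], one of maximal rank spans all directions of
    [S], since appending any further row cannot increase the rank. *)
Lemma affine_hull_rowspace S x0 : S x0 ->
  exists k (B : 'M[R]_(k, n)), (forall i, S (x0 + row i B)) /\
    forall y, affine_hull S y <-> (y - x0 <= B)%MS.
Proof.
move=> Sx0.
pose P r := `[< exists k (B : 'M[R]_(k, n)),
  (forall i, S (x0 + row i B)) /\ \rank B = r >].
have exP : exists r, P r.
  exists 0%N; apply/asboolP; exists 0%N, 0; split; first by case.
  by rewrite mxrank0.
have leP r : P r -> (r <= n)%N.
  by move=> /asboolP[k [B [_ <-]]]; exact: rank_leq_col.
case: (ex_maxnP exP leP) => _ /asboolP[k [B [SB <-]]] maxB.
exists k, B; split=> // y.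
have SsubB s : S s -> (s - x0 <= B)%MS.
  move=> Ss; pose B' := col_mx B (s - x0).
  have : (B <= B')%MS by rewrite -addsmxE addsmxSl.
  move/mxrank_leqif_sup => /leqifP; case: ifPn => [BB' _|_ lt].
    by apply: submx_trans BB'; rewrite -addsmxE addsmxSr.
  suff /maxB : P (\rank B') by rewrite leqNgt lt.
  apply/asboolP; exists (k + 1)%N, B'; split=> // i.
  case: (split_ordP i) => j ->; first by rewrite rowKu.
  by rewrite rowKd ord1 row_id addrC subrK.
split=> [[m [a [s [Ss a1 ->]]]]|/submxP[e yE]].
  have -> : \sum_i a i *: s i - x0 = \sum_i a i *: (s i - x0).
    rewrite (eq_bigr _ (fun i _ => scalerBr (a i) _ _)) sumrB.
    by rewrite -scaler_suml a1 scale1r.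
  by apply: summx_sub => i _; apply/scalemx_sub/SsubB.
(* The coefficients of e are completed by the weight 1 - \sum_j e_j on x0. *)
exists k.+1, (fun i => oapp (e 0) (1 - \sum_j e 0 j) (unlift ord0 i)).
exists (fun i => oapp (fun j => x0 + row j B) x0 (unlift ord0 i)).
split=> [i||]; first by case: unlift.
  rewrite big_ord_recl unlift_none /=.
  by under [X in _ + X]eq_bigr do rewrite liftK /=; rewrite subrK.
rewrite big_ord_recl unlift_none /=.
under [X in _ + X]eq_bigr do rewrite liftK /= scalerDr.
rewrite big_split /= -scaler_suml addrA -scalerDl subrK scale1r.
by rewrite -mulmx_sum_row -yE addrC subrK.
Qed.

Lemma affine_hull_comb S x y (a b : R) : a + b = 1 ->
  affine_hull S x -> affine_hull S y -> affine_hull S (a *: x + b *: y).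
Proof.
move=> ab Ax Ay.
have [x0 Sx0] : S !=set0.
  case: Ax => -[|k] [c [s [Ss c1 _]]]; last by exists (s ord0).
  by move: c1; rewrite big_ord0 => /eqP; rewrite eq_sym oner_eq0.
have [k [B [_ hullE]]] := affine_hull_rowspace S x0 Sx0.
move/hullE : Ax => Ax; move/hullE : Ay => Ay; apply/hullE.
have -> : a *: x + b *: y - x0 = a *: (x - x0) + b *: (y - x0).
  by rewrite !scalerBr addrACA -opprD -scalerDl ab scale1r.
by rewrite addmx_sub // scalemx_sub.
Qed.

(** * Relative interiors *)

Lemma near_mulmx_coord k (P : 'M[R]_(n, k)) (c : 'rV[R]_n) (e : R) : 0 < e ->
  \forall y \near c, forall i, `|((y - c) *m P) 0 i| <= e.
Proof.
move=> e0.
apply: (@filter_forall _ _ (fun i y => `|((y - c) *m P) 0 i| <= e) (nbhs c)).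
move=> i.
have Fc : continuous (fun y : 'rV[R]_n => (y *m P) 0 i).
  under eq_fun do rewrite mxE.
  apply: continuous_big => [|j _ y]; first exact: add_continuous.
  exact: (cvgM (@coord_continuous R 1 n 0 j y) (cvg_cst (P j i))).
have /cvgrPdist_le/(_ e e0) := Fc c.
apply: filterS => y.
suff -> : ((y - c) *m P) 0 i = (y *m P) 0 i - (c *m P) 0 i by rewrite distrC.
by rewrite mulmxBl !mxE.
Qed.

(** With rows v_i spanning the directions of [S], the point c that has weight
    u = 1 / (k + 1) on each x0 + v_i and on [x0] is relatively interior: a
    point of the affine hull near c differs from it by a combination of the
    v_i with small coefficients, obtained continuously from the pseudo-inverse
    of the matrix of the v_i.  When these are at most u ^ 2 in absolute value,
    all weights stay nonnegative, and those of the v_i sum to at most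
    (1 - u) (1 + u) <= 1. *)
Lemma rint_nonempty S : convex_set S -> S !=set0 -> rint S !=set0.
Proof.
move=> cS [x0 Sx0].
have [k [B [SB hullE]]] := affine_hull_rowspace S x0 Sx0.
pose u : R := k.+1%:R^-1.
have u0 : 0 < u by rewrite invr_gt0.
have ku : u *+ k = 1 - u.
  apply/eqP; rewrite eq_sym subr_eq -mulrSr -mulr_natr.
  by rewrite mulVf // pnatr_eq0.
have u1 : u <= 1 by rewrite invf_le1 // ler1n.
pose c := x0 + \sum_(i < k) u *: row i B.
have Sc : S c.
  apply: convex_bary => // [_|]; first exact: ltW.
  by rewrite sumr_const card_ord ku; lra.
exists c; split; first exact: sub_affine_hull.
have u20 : 0 < u ^+ 2 by rewrite exprn_gt0.
apply: filterS (near_mulmx_coord _ (pinvmx B) c _ u20) => y smalle.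
move=> Ay; set e := _ *m _ in smalle.
have /mulmxKpV yE : (y - c <= B)%MS.
  have -> : y - c = (y - x0) - (c - x0).
    by rewrite opprB addrA subrK.
  move/sub_affine_hull/hullE : Sc => Sc; move/hullE : Ay => Ay.
  by rewrite addmx_sub // eqmx_opp.
have -> : y = x0 + \sum_i (u + e 0 i) *: row i B.
  under eq_bigr do rewrite scalerDl.
  by rewrite big_split /= addrA -mulmx_sum_row yE addrC subrK.
apply: convex_bary => // [i|].
  have := smalle i; rewrite ler_norml => /andP[+ _].
  by rewrite expr2; nra.
apply: (@le_trans _ _ (\sum_(i < k) (u + u ^+ 2))).
  by apply: ler_sum => i _; rewrite lerD2l (le_trans (ler_norm _)).
by rewrite sumr_const card_ord mulrnDl expr2 -mulrnAr ku; nra.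
Qed.

(** The homothety of centre [y] that maps a x + b y to [x] is continuous and
    preserves the affine hull, so it maps the points of the hull near
    a x + b y into [S]; their preimages are convex combinations of points of
    [S] with [y]. *)
Lemma rint_segment S x y (a b : R) : convex_set S -> 0 < a -> 0 <= b ->
  a + b = 1 -> rint S x -> S y -> rint S (a *: x + b *: y).
Proof.
move=> cS a0 b0 ab [Ax nx] Sy.
have Ay := sub_affine_hull _ _ Sy.
split; first exact: affine_hull_comb.
pose h z := a^-1 *: (z - b *: y).
have hx : h (a *: x + b *: y) = x.
  by rewrite /h addrK scalerA mulVf ?scale1r // gt_eqF.
have hc : h z @[z --> a *: x + b *: y] --> x.
  rewrite -{2}hx.
  exact: (cvgZ (cvg_cst a^-1) (cvgB cvg_id (cvg_cst (b *: y)))).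
near=> z => Az.
have -> : z = a *: h z + b *: y.
  by rewrite scalerA mulfV ?gt_eqF // scale1r subrK.
move/convex_setP : (cS); apply => //; first exact: ltW.
have Sh : affine_hull S (h z) -> S (h z) by near: z; exact: hc nx.
apply: Sh; rewrite /h scalerBr scalerA -scaleNr.
apply: affine_hull_comb => //.
have -> : b = 1 - a by lra.
by field; rewrite gt_eqF.
Unshelve. all: by end_near. Qed.

(** * The span of the smallest face at the origin *)

(** For a convex [G] containing 0, this is the lineality space of the cone
    generated by [G]: the largest linear subspace contained in that cone. *)
Definition lineality G : set 'rV[R]_n :=
  [set u | exists2 r : R, 0 < r & G (r *: u) /\ G (- (r *: u))].

Section Lineality.
Variable G : set 'rV[R]_n.
Hypotheses (cG : convex_set G) (G0 : G 0).

Lemma convex_shrink u (a b : R) : 0 <= a -> a <= b -> 0 < b ->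
  G (b *: u) -> G (a *: u).
Proof.
move=> a0 ab b0 Gu; have /convex_setP cG' := cG.
have -> : a *: u = (a / b) *: (b *: u) + (1 - a / b) *: 0.
  by rewrite scaler0 addr0 scalerA divfK ?gt_eqF.
apply: cG' => //; last by rewrite addrC subrK.
- by rewrite divr_ge0 // ltW.
- by rewrite subr_ge0 ler_pdivrMr // mul1r.
Qed.

Lemma lineality0 : lineality G 0.
Proof. by exists 1 => //; rewrite scaler0 oppr0. Qed.

Lemma linealityD u v : lineality G u -> lineality G v -> lineality G (u + v).
Proof.
move=> [r r0 [ru rNu]] [s s0 [sv sNv]].
pose m := Num.min r s.
have m0 : 0 < m by rewrite lt_min r0.
have m_ge0 := ltW m0.
have mr : m <= r by rewrite ge_min lexx.
have ms : m <= s by rewrite ge_min lexx orbT.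
have half w z : G (m *: w) -> G (m *: z) -> G ((m / 2) *: (w + z)).
  move=> Gw Gz; have /convex_setP cG' := cG.
  have -> : (m / 2) *: (w + z) = 2^-1 *: (m *: w) + 2^-1 *: (m *: z).
    by rewrite scalerDr !scalerA [m / 2]mulrC.
  by apply: cG' => //; lra.
rewrite -!scalerN in rNu sNv.
exists (m / 2); first by rewrite divr_gt0.
rewrite -scalerN opprD; split; apply: half.
- exact: convex_shrink ru.
- exact: convex_shrink sv.
- exact: convex_shrink rNu.
- exact: convex_shrink sNv.
Qed.

Lemma linealityZ (a : R) u : lineality G u -> lineality G (a *: u).
Proof.
move=> [r r0 [ru rNu]].
have [->|a0] := eqVneq a 0; first by rewrite scale0r; exact: lineality0.
exists (r / `|a|); first by rewrite divr_gt0 ?normr_gt0.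
rewrite scalerA -mulrA.
have [ap|an] := ltrP 0 a.
  by rewrite gtr0_norm // mulVf // mulr1.
by rewrite ler0_norm // invrN mulNr mulVf // mulrN1 scaleNr opprK.
Qed.

Lemma open_segmentP x y z : open_segment y z x <->
  [/\ y != z & exists2 t : R, 0 < t < 1 & x = t *: y + (1 - t) *: z].
Proof.
split=> [[[t ->] /not_orP[ny nz]]|[yz [t /andP[t0 t1] ->]]].
  have yz : y != z by apply: contra_notN ny => /eqP <-; rewrite convmm.
  split=> //; exists t%:inum => //; rewrite !lt_neqAle ge0 le1 !andbT.
  apply/andP; split.
    rewrite eq_sym; apply: contra_notN nz => /eqP t0.
    rewrite [t](_ : _ = 0%:i01) ?conv0 //; exact/val_inj.
  apply: contra_notN ny => /eqP t1.
  by rewrite [t](_ : _ = 1%:i01) ?conv1 //; exact/val_inj.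
split; first by exists (Itv01 (ltW t0) (ltW t1)).
have yz0 : y - z != 0 by rewrite subr_eq0.
have E : t *: y + (1 - t) *: z = t *: (y - z) + z.
  by rewrite scalerBr scalerBl scale1r addrA addrAC.
rewrite E; case=> Eq.
  have /eqP : (t - 1) *: (y - z) = 0.
    by rewrite scalerBl scale1r -{2}Eq addrK subrr.
  by rewrite scaler_eq0 (negbTE yz0) subr_eq0 orbF lt_eqF.
have /eqP : t *: (y - z) = 0 by apply: (addIr z); rewrite Eq add0r.
by rewrite scaler_eq0 (negbTE yz0) orbF gt_eqF.
Qed.

(** If w = t y + (1 - t) z and -r w is in [G], then eliminating [z] between
    -r w and [z] shows that a negative multiple of [y] is in [G]. *)
Lemma face_lineality : is_face G (G `&` lineality G).
Proof.
split; first exact: subIsetl.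
have key y z (t : R) : 0 < t -> t < 1 -> G y -> G z ->
    lineality G (t *: y + (1 - t) *: z) -> lineality G y.
  move=> t0 t1 Gy Gz [r r0 [_ rNw]].
  have d0 : 0 < 1 + r * (1 - t) by nra.
  pose s := r * t / (1 + r * (1 - t)).
  have s0 : 0 < s by rewrite divr_gt0 ?mulr_gt0.
  have GNs : G (- (s *: y)).
    have /convex_setP cG' := cG.
    have -> : - (s *: y) =
        (1 + r * (1 - t))^-1 *: - (r *: (t *: y + (1 - t) *: z)) +
        (r * (1 - t) / (1 + r * (1 - t))) *: z.
      by apply/rowP => i; rewrite !mxE /s; field; rewrite gt_eqF.
    apply: cG' => //; first by rewrite invr_ge0 ltW.
      by rewrite divr_ge0 // ?mulr_ge0 ?ltW // subr_gt0.
    by field; rewrite gt_eqF.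
  (* y and -(s y) are in G; the common factor must not exceed 1 or s. *)
  exists (Num.min 1 s); first by rewrite lt_min ltr01.
  have m0 : 0 <= Num.min 1 s by rewrite le_min ler01 ltW.
  split.
    by apply: (@convex_shrink _ _ 1); rewrite ?scale1r // ge_min lexx.
  rewrite -scalerN; apply: (@convex_shrink _ _ s) => //.
    by rewrite ge_min lexx orbT.
  by rewrite scalerN.
move=> y z Gy Gz [x [/open_segmentP[_ [t /andP[t0 t1] ->]] [_ Lx]]].
split; split=> //; first exact: key Lx.
apply: (@key z y (1 - t)) => //; [lra|lra|].
by rewrite opprB addrC [1 + _]addrC subrK.
Qed.

(** The span is contained in the lineality space because the latter cuts out a
    face of [G].  For the converse, 0 is the midpoint of r u and -(r u), so
    that every face containing 0 contains r u. *)
Lemma linear_span_face0 :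
  linear_span (smallest_face G [set 0]) = lineality G.
Proof.
apply/seteqP; split=> [_ [k [a [s [Fs ->]]]]|u [r r0 [ru rNu]]].
  apply: big_ind => [||i _]; [exact: lineality0|exact: linealityD|].
  apply: linealityZ.
  have /(_ (G `&` lineality G)) := Fs i; case=> //; split.
    exact: face_lineality.
  by move=> _ ->; split=> //; exact: lineality0.
have FG0 : smallest_face G [set 0] 0.
  by move=> F [_ F0]; apply: F0.
have [->|u0] := eqVneq u 0.
  by exists 0%N, (fun=> 0), (fun=> 0); rewrite big_ord0; split=> // -[].
have [_ face] := @smallest_face_is_face R n G [set 0] (ltac:(by move=> _ ->)).
have [Fru _] : smallest_face G [set 0] (r *: u) /\
               smallest_face G [set 0] (- (r *: u)).
  apply: face => //; exists 0; split=> //; apply/open_segmentP; split.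
    rewrite -subr_eq0 opprK -mulr2n -scaler_nat !scaler_eq0 pnatr_eq0 /=.
    by rewrite (negbTE u0) gt_eqF.
  exists 2^-1; first by lra.
  have -> : 1 - 2^-1 = 2^-1 :> R by lra.
  by rewrite -scalerDr subrr scaler0.
exists 1%N, (fun=> r^-1), (fun=> r *: u); split=> //.
by rewrite big_ord1 scalerA mulVf ?scale1r // gt_eqF.
Qed.

End Lineality.

(** * The affine joint supporting subspace *)

Lemma minkowski_sub_convex C D : convex_set C -> convex_set D ->
  convex_set (minkowski_sub C D).
Proof.
move=> /convex_setP cC /convex_setP cD; apply/convex_setP.
move=> _ _ a b a0 b0 ab [c Cc [d Dd <-]] [c' Cc' [d' Dd' <-]].
exists (a *: c + b *: c'); first exact: cC.
exists (a *: d + b *: d'); first exact: cD.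
by rewrite !scalerBr opprD addrACA.
Qed.

Lemma lineality_capB C D x y : (C `&` D) x -> (C `&` D) y ->
  lineality (minkowski_sub C D) (x - y).
Proof.
move=> [Cx Dx] [Cy Dy]; exists 1 => //; rewrite scale1r opprB.
by split; [exists x => //; exists y|exists y => //; exists x].
Qed.

Lemma affine_joint_supporting_subspaceE C D x0 :
  convex_set C -> convex_set D -> C x0 -> D x0 ->
  affine_joint_supporting_subspace C D =
  [set z | lineality (minkowski_sub C D) (z - x0)].
Proof.
move=> cC cD Cx Dx.
have cG := minkowski_sub_convex _ _ cC cD.
have G0 : minkowski_sub C D 0 by exists x0 => //; exists x0; rewrite ?subrr.
rewrite /affine_joint_supporting_subspace /joint_supporting_subspace.
rewrite linear_span_face0 //; apply/seteqP; split=> [_ [t Lt [p CDp <-]]|].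
  by rewrite /= -addrA; apply: linealityD => //; exact: lineality_capB.
by move=> z Lz; exists (z - x0) => //; exists x0; rewrite ?subrK.
Qed.

End ConvexSets.

Theorem corollary4p5 (R : realType) (n : nat) (C D : set 'rV[R]_n)
    (hC : convex_set C) (hD : convex_set D) (hCD : C `&` D !=set0) :
  let Ta := affine_joint_supporting_subspace C D in
  rint (C `&` Ta) `&` rint (D `&` Ta) !=set0.
Proof.
case: hCD => x0 [Cx0 Dx0].
rewrite (affine_joint_supporting_subspaceE C D x0) // => Ta.
have cG := minkowski_sub_convex _ _ hC hD.
set G := minkowski_sub C D in cG Ta *.
have G0 : G 0 by exists x0 => //; exists x0; rewrite ?subrr.
have TaB x y : Ta x -> Ta y -> lineality G (x - y).
  move=> Tx Ty; have -> : x - y = (x - x0) + -1 *: (y - x0).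
    by rewrite scaleN1r opprB addrA subrK.
  by apply: linealityD => //; exact: linealityZ.
have TaD x y (a : R) : Ta x -> lineality G y -> Ta (x + a *: y).
  move=> Tx Ly; rewrite /Ta /= addrAC; apply: linealityD => //.
  exact: linealityZ.
have cTa : convex_set Ta.
  apply/convex_setP => x y a b _ _ ab Tx Ty.
  have -> : a *: x + b *: y = x + b *: (y - x).
    have -> : a = 1 - b by lra.
    by rewrite scalerBr scalerBl scale1r addrAC addrA.
  by apply: TaD => //; exact: TaB.
have cI S : convex_set S -> convex_set (S `&` Ta).
  move=> /convex_setP cS; apply/convex_setP => x y a b a0 b0 ab [Sx Tx] [Sy Ty].
  by split; [exact: cS|move/convex_setP: cTa; exact].
have Tx0 : Ta x0 by rewrite /Ta /= subrr; exact: lineality0.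
have [c rc] : rint (C `&` Ta) !=set0.
  by apply: rint_nonempty; [exact: cI|exists x0].
have [d rd] : rint (D `&` Ta) !=set0.
  by apply: rint_nonempty; [exact: cI|exists x0].
have [_ Tc] := rint_sub rc.
have [_ Td] := rint_sub rd.
have [r r0 [_ [c' Cc' [d' Dd' cdE]]]] := TaB _ _ Tc Td.
have s0 : 0 < 1 + r by rewrite addr_gt0.
pose a := r / (1 + r); pose b := (1 + r)^-1.
have a0 : 0 < a by rewrite divr_gt0.
have b0 : 0 <= b by rewrite invr_ge0 ltW.
have ab : a + b = 1 by rewrite /a /b; field; rewrite gt_eqF.
pose p := a *: c + b *: c'.
have pE : p = a *: d + b *: d'.
  have -> : p = a *: (c - d) + b *: (c' - d') + (a *: d + b *: d').
    by apply/rowP => i; rewrite !mxE; ring.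
  by rewrite cdE scalerN scalerA [b * r]mulrC subrr add0r.
have [Cc _] := rint_sub rc; have [Dd _] := rint_sub rd.
have Cp : C p by move/convex_setP: hC; apply => //; exact: ltW.
have Dp : D p by rewrite pE; move/convex_setP: hD; apply => //; exact: ltW.
have Tp : Ta p by apply: lineality_capB.
(* x' lies on the line through x and p, both of which are in Ta. *)
have beyond x x' : Ta x -> p = a *: x + b *: x' -> Ta x'.
  move=> Tx px; have -> : x' = p + r *: (p - x).
    rewrite px; apply/rowP => i; rewrite !mxE /a /b.
    by field; rewrite gt_eqF.
  by apply: TaD => //; exact: TaB.
exists p; split.
  by apply: rint_segment => //; [exact: cI|split => //; exact: beyond Tc _].
rewrite pE.
by apply: rint_segment => //; [exact: cI|split => //; exact: beyond Td pE].
Qed.
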